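(* Let $G=SO_8$ (split, type $\mathrm D_4$) and let $P$ be the maximal parabolic subgroup generated by all simple reflections except the first one (type $\mathrm A_3$; $G/P$ is a split $6$-dimensional smooth projective quadric). Then the $D$-module $D_P^\star$ is indecomposable over $\mathbb Z/2\mathbb Z$, i.e. for $R=\mathbb Z/2\mathbb Z$.
   Context: Chow theory with coefficient ring $R$. $\Sigma$ is the root system of type $\mathrm D_4$ with simple roots $\alpha_1,\dots,\alpha_4$ numbered so that $\alpha_2$ is the central vertex of the Dynkin diagram; $\omega_1$ is the first fundamental weight (the highest weight of the vector representation) and the character lattice of $SO_8$ is $T^*=\langle\alpha_1,\alpha_2,\alpha_3,\alpha_4,\omega_1\rangle$; $W=\langle s_1,s_2,s_3,s_4\rangle$ is the Weyl group and $W_P=\langle s_2,s_3,s_4\rangle$. $W^P$ is the set of minimal length representatives of $W/W_P$; for $w\in W$, $\overline w\in W^P$ is the minimal representative of $wW_P$. $S=\mathrm{Sym}_R(T^* )$ is the polynomial ring with its $W$-action, $Q$ is the localization of $S$ at all roots, and $Q_W$ is the twisted group algebra: the free left $Q$-module on $\delta_w$, $w\in W$, with $(q\delta_w)(q'\delta_{w'})=q\,w(q')\delta_{ww'}$. $D\subset Q_W$ is the subalgebra generated by $S$ and all $X_\alpha=\alpha^{-1}(1-\delta_{s_\alpha})$, $\alpha\in\Sigma$ (the nil affine Hecke algebra). $Q_{W/W_P}$ is the free $Q$-module on $\{\delta_w\}_{w\in W^P}$; $p\colon Q_W\to Q_{W/W_P}$, $q\delta_w\mapsto q\delta_{\overline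 w}$; $D_P=p(D)$. $Q_{W/W_P}^*=\mathrm{Hom}_Q(Q_{W/W_P},Q)$ has dual basis $\{f_w\}_{w\in W^P}$, and $D_P^\star=\mathrm{Hom}_S(D_P,S)=\{f\in Q_{W/W_P}^*: f(D_P)\subset S\}$, a $D$-module via the restriction of the $\odot$-action $q\delta_w\odot q'f_v=q\,w(q')f_{\overline{wv}}$ ($q,q'\in Q$, $w\in W$, $v\in W^P$) of $Q_W$ on $Q_{W/W_P}^*$. Indecomposable means that $\mathrm{End}_D(D_P^\star)$ has no non-trivial idempotents. *)

(* Defs.v *)
From HB Require Import structures.
From mathcomp Require Import all_boot all_order all_algebra all_fingroup.
From mathcomp Require Import boolp mpoly ring.

Set Implicit Arguments.
Unset Strict Implicit.
Unset Printing Implicit Defensive.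

Import Order.TTheory GRing.Theory Num.Theory.

Local Open Scope ring_scope.

(* Bourbaki coordinates: T^* is Z^4 with orthonormal basis eps_1 .. eps_4, the
   simple roots are eps_1 - eps_2, eps_2 - eps_3 (the central vertex),
   eps_3 - eps_4 and eps_3 + eps_4, and omega_1 = eps_1.  Indices start at 0,
   so the first simple root is [simple_root 0].  The lemmas [cartan_matrix],
   [omega1_fundamental] and [charlat_span] below validate this choice. *)
Notation charlat := 'rV[int]_4.

Definition eps (i : 'I_4) : charlat := delta_mx 0 i.

(* The signed index (i, b) stands for the weight (-1)^b eps_i of the vector
   representation. *)
Notation sidx := ('I_4 * bool)%type.

Definition sneg (x : sidx) : sidx := (x.1, ~~ x.2).

Definition wt (x : sidx) : charlat := (-1) ^+ x.2 *: eps x.1.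

Definition dot (a b : charlat) : int := \sum_i a 0 i * b 0 i.

Definition is_root (a : charlat) : bool :=
  [exists x : sidx, exists y : sidx, (x.1 != y.1) && (a == wt x + wt y)].

(* dot a a = 2 for every root a, so the coroot pairing is dot _ a. *)
Definition refl (a l : charlat) : charlat := l - dot l a *: a.

Local Notation o k := (@Ordinal 4 k isT).

Definition simple_pair (i : 'I_4) : sidx * sidx :=
  tnth [tuple ((o 0, false), (o 1, true)); ((o 1, false), (o 2, true));
              ((o 2, false), (o 3, true)); ((o 2, false), (o 3, false))] i.

Definition simple_root (i : 'I_4) : charlat :=
  wt (simple_pair i).1 + wt (simple_pair i).2.

Definition omega1 : charlat := eps 0.

(* W is realised by its faithful action on the orbit {+-eps_i} of omega_1.
   The reflection in wt x + wt y exchanges wt x with - wt y and wt y with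
   - wt x. *)
Definition refl_perm (xy : sidx * sidx) : {perm sidx} :=
  (tperm xy.1 (sneg xy.2) * tperm xy.2 (sneg xy.1))%g.

Definition weyl_group : {group {perm sidx}} :=
  <<[set refl_perm (simple_pair i) | i : 'I_4]>>%G.

Notation weyl := (subg_of weyl_group).

Lemma refl_perm_in i : refl_perm (simple_pair i) \in weyl_group.
Proof. by apply/mem_gen/imset_f. Qed.

Definition simple_refl (i : 'I_4) : weyl := Subg (refl_perm_in i).

(* The inverse turns the right action of permutations ((s * t) x = t (s x))
   into a left action of W on T^*. *)
Definition wact (w : weyl) (l : charlat) : charlat :=
  \sum_i l 0 i *: wt ((sgval w)^-1%g (i, false)).

Lemma weyl_word (w : weyl) :
  exists n, [exists t : n.-tuple 'I_4, w == (\prod_(i <- t) simple_refl i)%g].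
Proof.
have [n [c cA def_w]] := gen_prodgP (subgP w).
have /fin_all_exists [f fE] : forall i, exists j, c i = refl_perm (simple_pair j).
  by move=> i; have /imsetP[j _ ->] := cA i; exists j.
exists n; apply/existsP; exists [tuple f i | i < n].
apply/eqP/val_inj; rewrite big_tuple /= def_w.
rewrite (@big_morph _ _ sgval 1%g _ 1%g _ (fun x y => erefl) erefl).
by apply: eq_bigr => i _; rewrite tnth_mktuple fE.
Qed.

Definition ell (w : weyl) : nat := ex_minn (weyl_word w).

Definition parabolic : {group weyl} :=
  <<[set simple_refl i | i : 'I_4 & i != 0]>>%G.

(* The minimal length element of a coset is unique by the general theory of
   Coxeter groups; the choice made by [pick] depends on the coset only. *)
Definition minrep (w : weyl) : weyl :=
  odflt 1%g [pick x in (w *: parabolic)%g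
            | [forall y in (w *: parabolic)%g, (ell x <= ell y)%N]].

Definition is_minrep : pred weyl := [pred v | v \in codom minrep].

Notation minreps := {v : weyl | is_minrep v}.

Lemma minrepP w : is_minrep (minrep w).
Proof. exact: codom_f. Qed.

Definition bar (w : weyl) : minreps := Sub (minrep w) (minrepP w).

Lemma minrep_in w : minrep w \in (w *: parabolic)%g.
Proof.
rewrite /minrep; case: pickP => [x /andP[]//|/=].
case: (@arg_minnP _ w (fun x => x \in (w *: parabolic)%g) ell (lcoset_refl _ _)).
move=> x xin xmin /(_ x); rewrite xin /= => /negbT/negP[].
by apply/forall_inP.
Qed.

Lemma minrep_eq w w' : (w *: parabolic = w' *: parabolic)%g -> minrep w = minrep w'.
Proof. by rewrite /minrep => ->. Qed.

Lemma bar_id (v : minreps) : bar (val v) = v.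
Proof.
apply: val_inj => /=; case: v => v /= /codomP[w ->]; apply: minrep_eq.
by apply/lcoset_eqP/minrep_in.
Qed.

Lemma barM u w : bar (u * val (bar w))%g = bar (u * w)%g.
Proof.
apply: val_inj => /=; apply: minrep_eq; rewrite !lcosetM; congr (_ *: _)%g.
by apply/lcoset_eqP/minrep_in.
Qed.

Lemma bar_lmul u w w' : bar w = bar w' -> bar (u * w)%g = bar (u * w')%g.
Proof. by rewrite -(barM u w) -(barM u w') => ->. Qed.

Lemma wt_sneg x : wt (sneg x) = - wt x.
Proof.
by rewrite /wt /=; case: x.2; rewrite ?expr0 ?expr1 ?scale1r ?scaleN1r ?opprK.
Qed.

Lemma sneg_inj : injective sneg.
Proof. by move=> [i []] [j []] [] ->. Qed.

Lemma dot_wt x y : dot (wt x) (wt y) = (x == y)%:R - (x == sneg y)%:R.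
Proof.
rewrite /dot (bigD1 x.1) //= big1 ?addr0; last first.
  by move=> i /negPf nix; rewrite !mxE nix andbF mulr0 mul0r.
rewrite !mxE !eqxx /= mulr1.
case: x y => [i b] [j c]; rewrite -!pair_eqE /pair_eq /= /sneg.
by case: eqP => //= _; case: b; case: c.
Qed.

Lemma dotDr a b c : dot a (b + c) = dot a b + dot a c.
Proof. by rewrite -big_split; apply: eq_bigr => i _; rewrite mxE mulrDr. Qed.

Lemma dotDl a b c : dot (a + b) c = dot a c + dot b c.
Proof. by rewrite -big_split; apply: eq_bigr => i _; rewrite mxE mulrDl. Qed.

Lemma sneg_neq x : (x == sneg x) = false.
Proof. by case: x => i []; rewrite -pair_eqE /pair_eq /= andbF. Qed.

Lemma snegK : involutive sneg.
Proof. by case=> i []. Qed.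

Lemma sneg_eq x y : (sneg x == y) = (x == sneg y).
Proof. by rewrite -(inj_eq sneg_inj) snegK. Qed.

Lemma sidx_neq x y : x.1 != y.1 ->
  [/\ [/\ x <> y, x <> sneg y & sneg x <> y],
      [/\ x <> sneg x, y <> sneg y & sneg x <> sneg y],
      sneg (sneg x) = x & sneg (sneg y) = y].
Proof.
move=> /eqP xy; have sn z : z <> sneg z by apply/eqP; rewrite sneg_neq.
split; rewrite ?snegK //; split; try exact: sn.
- by move=> e; apply: xy; rewrite e.
- by move=> e; apply: xy; rewrite e.
- by move=> e; apply: xy; rewrite -e.
- by move=> /sneg_inj e; apply: xy; rewrite e.
Qed.

Lemma refl_permE x y z : x.1 != y.1 ->
  refl_perm (x, y) z = if z == x then sneg y else if z == y then sneg x
    else if z == sneg x then y else if z == sneg y then x else z.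
Proof.
move=> /sidx_neq[[? ? ?] [? ? ?] ? ?]; rewrite /refl_perm /= permM.
by case: (tpermP x) => [->|->|? ?]; case: tpermP => *;
   do ?[case: eqP => ?]; congruence.
Qed.

Lemma refl_permV x y : x.1 != y.1 -> ((refl_perm (x, y))^-1 = refl_perm (x, y))%g.
Proof.
move=> xy; apply/eqP; rewrite eq_invg_mul; apply/eqP/permP => z.
rewrite permM perm1 (refl_permE z xy); have [[? ? ?] [? ? ?] ? ?] := sidx_neq xy.
by do ?[case: eqP => ?]; rewrite (refl_permE _ xy); do ?[case: eqP => ?]; congruence.
Qed.

Lemma refl_perm_sneg x y z : x.1 != y.1 ->
  refl_perm (x, y) (sneg z) = sneg (refl_perm (x, y) z).
Proof.
move=> xy; rewrite !refl_permE //; have zK := snegK z.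
have [[? ? ?] [? ? ?] ? ?] := sidx_neq xy.
by do ?[case: eqP => ?]; congruence.
Qed.

Lemma wt_refl_perm x y z : x.1 != y.1 ->
  wt (refl_perm (x, y) z) = refl (wt x + wt y) (wt z).
Proof.
move=> xy; rewrite !refl_permE // /refl dotDr !dot_wt.
have [[? ? ?] [? ? ?] ? ?] := sidx_neq xy.
do ?[case: eqP => ?]; try congruence; subst; rewrite ?wt_sneg /=.
all: rewrite ?subr0 ?sub0r ?addr0 ?add0r ?scale1r ?scaleN1r ?scale0r ?subr0 //.
all: rewrite ?opprD ?opprK ?addrA ?subrr ?addNr ?sub0r ?add0r //.
all: by rewrite addrC addrA ?addNr ?subrr ?add0r.
Qed.

Lemma simple_pair_neq i : (simple_pair i).1.1 != (simple_pair i).2.1.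
Proof. by case: i => [[|[|[|[|]]]] ?]. Qed.

Lemma simple_reflV i : (simple_refl i)^-1%g = simple_refl i.
Proof.
apply: val_inj => /=; have := simple_pair_neq i.
by case: (simple_pair i) => x y /refl_permV.
Qed.

Lemma weyl_sneg (w : weyl) x : sgval w (sneg x) = sneg (sgval w x).
Proof.
have [n [c cA ->]] := gen_prodgP (subgP w).
elim/big_ind: _ x => [x|u v IHu IHv x|i _ x]; first by rewrite !perm1.
  by rewrite !permM IHu IHv.
have /imsetP[j _ ->] := cA i.
by have := simple_pair_neq j; case: (simple_pair j) => y z /refl_perm_sneg->.
Qed.

Definition sact (w : weyl) (x : sidx) : sidx := (sgval w)^-1%g x.

Lemma sact_sneg w x : sact w (sneg x) = sneg (sact w x).
Proof. exact: (weyl_sneg w^-1%g). Qed.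

Lemma sactM u v x : sact (u * v)%g x = sact u (sact v x).
Proof. by rewrite /sact /= invMg permM. Qed.

Lemma sact1 x : sact 1%g x = x.
Proof. by rewrite /sact /= invg1 perm1. Qed.

Lemma wactB w a b : wact w (a - b) = wact w a - wact w b.
Proof.
rewrite /wact -sumrB; apply: eq_bigr => i _.
by rewrite !mxE scalerBl.
Qed.

Lemma wact0 w : wact w 0 = 0.
Proof. by rewrite -[X in wact _ X](subrr 0) wactB subrr. Qed.

Lemma wactN w a : wact w (- a) = - wact w a.
Proof. by rewrite -sub0r wactB wact0 sub0r. Qed.

Lemma wactD w a b : wact w (a + b) = wact w a + wact w b.
Proof. by rewrite -{1}[b]opprK wactB wactN opprK. Qed.

Lemma wactZ w k a : wact w (k *: a) = k *: wact w a.
Proof.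
rewrite /wact scaler_sumr; apply: eq_bigr => i _.
by rewrite !mxE scalerA.
Qed.

Lemma wact_wt w x : wact w (wt x) = wt (sact w x).
Proof.
suff weps i : wact w (eps i) = wt (sact w (i, false)).
  case: x => i [] /=; rewrite {1}/wt /= wactZ weps ?expr0 ?scale1r //.
  by rewrite expr1 scaleN1r -wt_sneg -sact_sneg.
rewrite /wact (bigD1 i) //= big1 ?addr0 => [|j /negPf nij].
  by rewrite !mxE !eqxx scale1r.
by rewrite !mxE nij andbF scale0r.
Qed.

Lemma wt_eps i : wt (i, false) = eps i.
Proof. by rewrite /wt expr0 scale1r. Qed.

Lemma charlat_eps (l : charlat) : l = \sum_i l 0 i *: wt (i, false).
Proof. by rewrite [LHS]row_sum_delta; under [RHS]eq_bigr do rewrite wt_eps. Qed.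

Lemma wact_sum w (I : finType) (F : I -> charlat) :
  wact w (\sum_i F i) = \sum_i wact w (F i).
Proof. exact: (big_morph _ (wactD w) (wact0 w)). Qed.

Lemma wactM u v l : wact (u * v)%g l = wact u (wact v l).
Proof.
rewrite (charlat_eps l) (wact_sum (u * v)%g) (wact_sum v) (wact_sum u).
by apply: eq_bigr => i _; rewrite (wactZ (u * v)%g) (wactZ v) (wactZ u) !wact_wt sactM.
Qed.

Lemma wact1 l : wact 1%g l = l.
Proof.
rewrite {2}(charlat_eps l) [in LHS](charlat_eps l) wact_sum.
by apply: eq_bigr => i _; rewrite wactZ wact_wt sact1.
Qed.

Lemma reflD a l m : refl a (l + m) = refl a l + refl a m.
Proof. by rewrite /refl dotDl scalerDl opprD addrACA. Qed.

Lemma reflZ a k l : refl a (k *: l) = k *: refl a l.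
Proof.
rewrite /refl scalerBr scalerA; congr (_ - _ *: _); rewrite /dot mulr_sumr.
by apply: eq_bigr => i _; rewrite mxE mulrA.
Qed.

Lemma refl0 a : refl a 0 = 0.
Proof. by rewrite -(scale0r 0) reflZ !scale0r. Qed.

(* The generators of W act on T^* as the simple reflections. *)
Lemma wact_simple_refl i l : wact (simple_refl i) l = refl (simple_root i) l.
Proof.
rewrite (charlat_eps l) wact_sum.
rewrite (big_morph _ (reflD (simple_root i)) (refl0 _)); apply: eq_bigr => j _.
rewrite wactZ wact_wt reflZ; congr (_ *: _); rewrite /sact /simple_root /=.
have := simple_pair_neq i; case: (simple_pair i) => x y xy /=.
by rewrite refl_permV // wt_refl_perm.
Qed.

Lemma wt_inj : injective wt.
Proof.
move=> x y exy; have := dot_wt x x; rewrite {2}exy dot_wt eqxx sneg_neq.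
by case: eqP => // _; case: eqP.
Qed.

Lemma wact_faithful u v : wact u =1 wact v -> u = v.
Proof.
move=> uv; apply/invg_inj/val_inj/permP => x; apply: wt_inj.
by have := uv (wt x); rewrite !wact_wt.
Qed.

(* The Dynkin diagram is D_4, with central vertex alpha_2. *)
Lemma cartan_matrix i j : dot (simple_root i) (simple_root j)
  = if i == j then 2 else if (i == o 1) || (j == o 1) then -1 else 0.
Proof.
rewrite /simple_root dotDr.
have dotC (a b : charlat) : dot a b = dot b a.
  by apply: eq_bigr => k _; rewrite mulrC.
rewrite !(dotC (_ + _)) !dotDr !dot_wt.
by move: i j => [[|[|[|[|//]]]] ?] [[|[|[|[|//]]]] ?].
Qed.

Lemma omega1_fundamental i : dot omega1 (simple_root i) = (i == 0)%:R.
Proof.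
by rewrite /omega1 -wt_eps dotDr !dot_wt; move: i => [[|[|[|[|//]]]] ?].
Qed.

Lemma sum4 (V : nmodType) (F : 'I_4 -> V) :
  \sum_i F i = F (o 0) + F (o 1) + F (o 2) + F (o 3).
Proof.
rewrite !big_ord_recl big_ord0 addr0 !addrA.
by congr (_ + _ + _ + _); congr F; apply: val_inj.
Qed.

(* T^* is generated by the simple roots and omega_1. *)
Lemma charlat_span (l : charlat) : exists (c : 'I_4 -> int) (d : int),
  l = \sum_i c i *: simple_root i + d *: omega1.
Proof.
exists (fun i => - \sum_(j < 4 | (i < j)%N) l 0 j), (\sum_j l 0 j).
rewrite [LHS]charlat_eps !sum4 /simple_root /=.
rewrite !(wt_sneg (_, false)) /omega1 !(big_mkcond (fun j : 'I_4 => _ < _)%N).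
rewrite !sum4 /= -wt_eps.
have -> : (0 : 'I_4) = o 0 by apply: val_inj.
apply/rowP => j; rewrite !(mxE, wt_eps) /=; ring.
Qed.

Lemma refl_permJ x y (w : weyl) :
  (refl_perm (x, y) ^ sgval w)%g = refl_perm (sgval w x, sgval w y).
Proof. by rewrite /refl_perm conjMg !tpermJ !weyl_sneg. Qed.

Lemma weyl_neq (w : weyl) x1 y1 : x1.1 != y1.1 -> (sgval w x1).1 != (sgval w y1).1.
Proof.
move=> xy; apply/eqP; case ex: (sgval w x1) => [i b].
case ey: (sgval w y1) => [j c] /= ij; subst j.
have [[n1 n2 n3] _ _ _] := sidx_neq xy.
have [bc|bc] := eqVneq b c.
  by case: n1; apply: (@perm_inj _ (sgval w)); rewrite ex ey bc.
case: n2; apply: (@perm_inj _ (sgval w)); rewrite weyl_sneg ex ey /sneg /=.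
by move: bc; case: b {ex}; case: c {ey}.
Qed.

Lemma refl_perm_in_weyl x y : x.1 != y.1 -> refl_perm (x, y) \in weyl_group.
Proof.
pose M (x1 y1 : sidx) := (x1.1 != y1.1) && (refl_perm (x1, y1) \in weyl_group).
suff : x.1 != y.1 -> M x y by move=> h /h/andP[].
have sE i z : sgval (simple_refl i) z = let: (x, y) := simple_pair i in
  if z == x then sneg y else if z == y then sneg x
    else if z == sneg x then y else if z == sneg y then x else z.
  rewrite /=; have := simple_pair_neq i; case: (simple_pair i) => x1 y1.
  exact: refl_permE.
have step i x1 y1 : M x1 y1 -> M (sgval (simple_refl i) x1) (sgval (simple_refl i) y1).
  by move=> /andP[n h]; rewrite /M weyl_neq // -refl_permJ groupJ // subgP.
have sym x1 y1 : M x1 y1 -> M y1 x1.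
  move=> /andP[n h]; rewrite /M eq_sym n -refl_permV 1?eq_sym //.
  by rewrite /refl_perm invMg !tpermV.
have opp x1 y1 : M x1 y1 -> M (sneg x1) (sneg y1).
  move=> /andP[n h]; rewrite /M n /refl_perm /= !snegK.
  have /sym/andP[_] : M x1 y1 by rewrite /M n.
  by rewrite /refl_perm /= (tpermC y1) (tpermC x1).
have opp' i j b c : M (i, ~~ b) (j, ~~ c) -> M (i, b) (j, c).
  by move/opp; rewrite /sneg /= !negbK.
have simp i : M (simple_pair i).1 (simple_pair i).2.
  rewrite /M simple_pair_neq /=; have := refl_perm_in i.
  by case: (simple_pair i).
have m01 : M (o 0, false) (o 1, true) := simp (o 0).
have m12 : M (o 1, false) (o 2, true) := simp (o 1).
have m23 : M (o 2, false) (o 3, true) := simp (o 2).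
have p23 : M (o 2, false) (o 3, false) := simp (o 3).
have m02 : M (o 0, false) (o 2, true) by have := step (o 1) _ _ m01; rewrite !sE.
have m03 : M (o 0, false) (o 3, true) by have := step (o 2) _ _ m02; rewrite !sE.
have m13 : M (o 1, false) (o 3, true) by have := step (o 2) _ _ m12; rewrite !sE.
have p13 : M (o 1, false) (o 3, false) by have := step (o 1) _ _ p23; rewrite !sE.
have p03 : M (o 0, false) (o 3, false) by have := step (o 0) _ _ p13; rewrite !sE.
have p12 : M (o 1, false) (o 2, false) by have := step (o 2) _ _ p13; rewrite !sE.
have p02 : M (o 0, false) (o 2, false) by have := step (o 2) _ _ p03; rewrite !sE.
have p01 : M (o 0, false) (o 1, false) by have := step (o 1) _ _ p02; rewrite !sE.
move: x y => [[[|[|[|[|//]]]] hi] b] [[[|[|[|[|//]]]] hj] c] //= _.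
all: rewrite (bool_irrelevance hi isT) (bool_irrelevance hj isT).
all: case: b; case: c; first [done | by apply: sym | by apply: opp' | by apply/sym/opp'].
Qed.

(* Every reflection s_a, a a root, belongs to W; it is unique by [wact_faithful]. *)
Lemma reflection_exists a : is_root a -> exists w, wact w =1 refl a.
Proof.
move=> /existsP[x /existsP[y /andP[xy /eqP->]]].
exists (Subg (refl_perm_in_weyl xy)) => l.
rewrite (charlat_eps l) wact_sum.
rewrite (big_morph _ (reflD (wt x + wt y)) (refl0 _)); apply: eq_bigr => j _.
by rewrite wactZ wact_wt reflZ /sact /= refl_permV // wt_refl_perm.
Qed.

Section Fraction.
Variable A : idomainType.
Implicit Types x y : {fraction A}.

Definition numer x : A := \n_(generic_quotient.repr x).
Definition denom x : A := \d_(generic_quotient.repr x).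

Lemma frac_repr x : x = tofrac (numer x) / tofrac (denom x).
Proof.
have d0 : tofrac (denom x) != 0 by rewrite tofrac_eq0 denom_ratioP.
apply: (canRL (mulfK d0)); rewrite -[X in X * _](@generic_quotient.reprK _ _ x).
rewrite /numer /denom; move: (generic_quotient.repr x) => r.
unlock FracField.tofrac; rewrite -[LHS]FracField.pi_mul.
apply/generic_quotient.eqmodP; rewrite /= FracField.equivfE /FracField.mulf.
rewrite !numden_Ratio ?mulf_neq0 ?denom_ratioP ?oner_neq0 //.
by rewrite !mulr1 mulrC.
Qed.

Lemma frac_ind (P : {fraction A} -> Prop) :
  (forall a b : A, b != 0 -> P (tofrac a / tofrac b)) -> forall x, P x.
Proof. by move=> h x; rewrite (frac_repr x); apply: h; exact: denom_ratioP. Qed.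

Lemma tofrac_neq0 (b : A) : b != 0 -> tofrac b != 0.
Proof. by rewrite tofrac_eq0. Qed.

Definition frac_map (f : A -> A) x : {fraction A} :=
  tofrac (f (numer x)) / tofrac (f (denom x)).

Section FracMap.
Variable f : {rmorphism A -> A}.
Hypothesis f_neq0 : forall a, a != 0 -> f a != 0.

Lemma frac_map_div a b : b != 0 ->
  frac_map f (tofrac a / tofrac b) = tofrac (f a) / tofrac (f b).
Proof.
move=> b0; set x := tofrac a / tofrac b; rewrite /frac_map.
have d0 : denom x != 0 by exact: denom_ratioP.
have : x == tofrac (numer x) / tofrac (denom x) by rewrite -frac_repr.
rewrite /x eqr_div ?tofrac_neq0 // -!rmorphM tofrac_eq -/x => /eqP e.
apply/eqP; rewrite eqr_div ?tofrac_neq0 ?f_neq0 // -!tofracM -!rmorphM -e.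
by rewrite eqxx.
Qed.

Lemma frac_map_tofrac a : frac_map f (tofrac a) = tofrac (f a).
Proof.
by rewrite -[X in frac_map f X]divr1 -tofrac1 frac_map_div ?oner_neq0 // !rmorph1 divr1.
Qed.

Lemma frac_map_is_zmod_morphism : zmod_morphism (frac_map f).
Proof.
elim/frac_ind=> a b b0; elim/frac_ind=> c d d0.
have [tb td] := (tofrac_neq0 b0, tofrac_neq0 d0).
rewrite -mulNr -tofracN addf_div // -!(tofracM, tofracD).
rewrite !frac_map_div ?mulf_neq0 // -mulNr -tofracN addf_div ?tofrac_neq0 ?f_neq0 //.
by rewrite -!(tofracM, tofracD) !(rmorphM, rmorphD, rmorphN).
Qed.

Lemma frac_map_is_monoid_morphism : monoid_morphism (frac_map f).
Proof.
split; first by rewrite -tofrac1 frac_map_tofrac !rmorph1.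
elim/frac_ind=> a b b0; elim/frac_ind=> c d d0.
rewrite mulf_div -!tofracM !frac_map_div ?mulf_neq0 // mulf_div -!tofracM.
by rewrite !rmorphM.
Qed.

End FracMap.

Variables (I : Type) (P : pred I) (g : I -> A).

(* The localization of A at the elements g i, for i satisfying P. *)
Definition in_loc : pred {fraction A} := fun x => `[< exists (s : A) (rs : seq I),
  all P rs /\ x = tofrac s / tofrac (\prod_(i <- rs) g i) >].

Hypothesis g_neq0 : forall i, P i -> g i != 0.

Lemma prod_loc_neq0 rs : all P rs -> \prod_(i <- rs) g i != 0.
Proof.
elim: rs => [|i rs IH] /=; first by rewrite big_nil oner_neq0.
by case/andP=> /g_neq0 i0 /IH; rewrite big_cons mulf_eq0 negb_or i0.
Qed.

Lemma in_loc_tofrac s : tofrac s \in in_loc.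
Proof. by apply/asboolP; exists s, [::]; rewrite big_nil rmorph1 divr1. Qed.

Lemma in_loc_inv i : P i -> (tofrac (g i))^-1 \in in_loc.
Proof.
move=> Pi; apply/asboolP; exists 1, [:: i].
by rewrite /= Pi big_seq1 rmorph1 div1r.
Qed.

Lemma in_loc_subring : subring_closed in_loc.
Proof.
split; first by rewrite -tofrac1 in_loc_tofrac.
- move=> x y /asboolP[s [rs [Hrs ->]]] /asboolP[t [ts [Hts ->]]]; apply/asboolP.
  exists (s * (\prod_(i <- ts) g i) - t * (\prod_(i <- rs) g i)), (rs ++ ts).
  split; first by rewrite all_cat Hrs.
  rewrite big_cat -mulNr -tofracN addf_div ?tofrac_neq0 ?prod_loc_neq0 //.
  by rewrite -!(tofracM, tofracD) /= mulNr.
- move=> x y /asboolP[s [rs [Hrs ->]]] /asboolP[t [ts [Hts ->]]]; apply/asboolP.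
  exists (s * t), (rs ++ ts); split; first by rewrite all_cat Hrs.
  by rewrite big_cat mulf_div -!tofracM.
Qed.

Lemma frac_map_loc (f : {rmorphism A -> A}) (h : I -> I) :
    (forall a, a != 0 -> f a != 0) -> (forall i, P i -> P (h i)) ->
    (forall i, f (g i) = g (h i)) ->
  forall x, x \in in_loc -> frac_map f x \in in_loc.
Proof.
move=> f0 Ph fg x /asboolP[s [rs [rsP ->]]]; apply/asboolP.
exists (f s), (map h rs); split; first by rewrite all_map; apply: sub_all rsP.
rewrite frac_map_div ?prod_loc_neq0 // rmorph_prod big_map.
by under eq_bigr do rewrite fg.
Qed.

End Fraction.

Section Sym.
Variable R : idomainType.

(* S = Sym_R(T^* ), with 'X_i the class of eps_i. *)
Notation S := {mpoly R[4]}.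
Notation K := {fraction S}.

Definition lin (l : charlat) : S := \sum_i (l 0 i)%:~R *: 'X_i.

Definition wactS (w : weyl) (p : S) : S :=
  p \mPo [tuple lin (wact w (eps i)) | i < 4].

HB.instance Definition _ w := GRing.RMorphism.copy (wactS w)
  (comp_mpoly [tuple lin (wact w (eps i)) | i < 4]).

Lemma wactSC w c : wactS w c%:MP = c%:MP.
Proof. exact: comp_mpolyC. Qed.

Lemma wactSX w i : wactS w 'X_i = lin (wact w (eps i)).
Proof. by rewrite /wactS comp_mpolyXU -tnth_nth tnth_mktuple. Qed.

Lemma lin_is_additive : zmod_morphism lin.
Proof.
move=> a b; rewrite -sumrB; apply: eq_bigr => i _.
by rewrite !mxE rmorphB scalerBl.
Qed.

HB.instance Definition _ := GRing.isZmodMorphism.Build charlat S lin lin_is_additive.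

Lemma lin_eps i : lin (eps i) = 'X_i.
Proof.
rewrite /lin (bigD1 i) //= big1 ?addr0 => [|j /negPf nij].
  by rewrite !mxE !eqxx scale1r.
by rewrite !mxE nij andbF scale0r.
Qed.

Lemma linZ k a : lin (k *: a) = k%:~R *: lin a.
Proof.
rewrite /lin scaler_sumr; apply: eq_bigr => i _.
by rewrite !mxE rmorphM scalerA.
Qed.

Lemma wactS_lin w l : wactS w (lin l) = lin (wact w l).
Proof.
rewrite (charlat_eps l) wact_sum !(raddf_sum lin) rmorph_sum /=.
apply: eq_bigr => i _; rewrite wt_eps wactZ !linZ -!mul_mpolyC rmorphM /= wactSC.
by rewrite lin_eps wactSX.
Qed.

Lemma S_ind (P : S -> Prop) :
  (forall c, P c%:MP) -> (forall i, P 'X_i) ->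
  (forall p q, P p -> P q -> P (p + q)) ->
  (forall p q, P p -> P q -> P (p * q)) -> forall p, P p.
Proof.
move=> PC PX PD PM p; rewrite (mpolyE p).
apply: (big_ind P) => [|//|m _]; first by rewrite -mpolyC0.
rewrite -mul_mpolyC mpolyXE_id; apply: (PM _ _ (PC _)).
apply: (big_ind P) => [|//|i _]; first by rewrite -mpolyC1.
elim: (m i) => [|k IH]; first by rewrite expr0 -mpolyC1.
by rewrite exprS; apply: PM.
Qed.

Lemma wactS1 p : wactS 1%g p = p.
Proof.
elim/S_ind: p => [c|i|p q IHp IHq|p q IHp IHq].
- exact: wactSC.
- by rewrite wactSX wact1 lin_eps.
- by rewrite rmorphD /= IHp IHq.
- by rewrite rmorphM /= IHp IHq.
Qed.

Lemma wactSM u v p : wactS (u * v)%g p = wactS u (wactS v p).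
Proof.
elim/S_ind: p => [c|i|p q IHp IHq|p q IHp IHq].
- by rewrite !wactSC.
- by rewrite !wactSX wactS_lin wactM.
- by rewrite !rmorphD /= IHp IHq.
- by rewrite !rmorphM /= IHp IHq.
Qed.

Lemma wactS_inj w : injective (wactS w).
Proof.
by move=> p q /(congr1 (wactS w^-1%g)); rewrite -!wactSM mulVg !wactS1.
Qed.

Lemma wactS_eq0 w p : (wactS w p == 0) = (p == 0).
Proof. by rewrite -{1}(rmorph0 (wactS w)) (inj_eq (@wactS_inj w)). Qed.

Lemma lin_root_neq0 a : is_root a -> lin a != 0.
Proof.
move=> /existsP[[i b] /existsP[[j c] /andP[/= ij /eqP->]]].
have linwt k d : lin (wt (k, d)) = (-1) ^+ d *: 'X_k.
  by rewrite /wt linZ lin_eps rmorphXn rmorphN1.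
apply/eqP => /(congr1 (fun p : S => p@_U_(i)%MM)).
rewrite raddfD /= !linwt mcoeffD !mcoeffZ !mcoeffX mcoeff0 eqxx.
rewrite (_ : (U_(j)%MM == U_(i)%MM) = false); last first.
  by apply/eqP => /mnmP/(_ i); rewrite !mnm1E eqxx eq_sym (negPf ij).
by rewrite mulr1 mulr0 addr0 => /eqP; rewrite signr_eq0.
Qed.

(* a | p - s_a(p) in S *)
Lemma divided_difference a w : wact w =1 refl a ->
  forall p, exists q, p - wactS w p = lin a * q.
Proof.
move=> wE; elim/S_ind => [c|i|p q [p' pE] [q' qE]|p q [p' pE] [q' qE]].
- by exists 0; rewrite wactSC subrr mulr0.
- exists (dot (eps i) a)%:~R%:MP; rewrite wactSX wE /refl raddfB /= lin_eps.
  by rewrite opprB addrC subrK linZ mulrC mul_mpolyC.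
- by exists (p' + q'); rewrite rmorphD mulrDr -pE -qE opprD addrACA.
- exists (p' * q + wactS w p * q'); rewrite rmorphM /= mulrDr mulrA -pE.
  by rewrite mulrCA -qE mulrBl mulrBr addrA subrK.
Qed.

Lemma wactS_neq0 w p : p != 0 -> wactS w p != 0.
Proof. by rewrite wactS_eq0. Qed.

Definition wactK (w : weyl) : K -> K := frac_map (wactS w).

Definition wactK_is_zmod_morphism w : zmod_morphism (wactK w) :=
  frac_map_is_zmod_morphism (@wactS_neq0 w).
Definition wactK_is_monoid_morphism w : monoid_morphism (wactK w) :=
  frac_map_is_monoid_morphism (@wactS_neq0 w).

HB.instance Definition _ w := GRing.isZmodMorphism.Build K K (wactK w)
  (wactK_is_zmod_morphism w).
HB.instance Definition _ w := GRing.isMonoidMorphism.Build K K (wactK w)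
  (wactK_is_monoid_morphism w).

Lemma wactK_div w a b : b != 0 ->
  wactK w (tofrac a / tofrac b) = tofrac (wactS w a) / tofrac (wactS w b).
Proof. exact: (frac_map_div (@wactS_neq0 w)). Qed.

Lemma wactK_tofrac w a : wactK w (tofrac a) = tofrac (wactS w a).
Proof. exact: (frac_map_tofrac (@wactS_neq0 w)). Qed.

Lemma wactK1 x : wactK 1%g x = x.
Proof. by elim/frac_ind: x => a b b0; rewrite [LHS]wactK_div // !wactS1. Qed.

Lemma wactKM u v x : wactK (u * v)%g x = wactK u (wactK v x).
Proof.
elim/frac_ind: x => a b b0.
rewrite (wactK_div _ a b0) (wactK_div v a b0).
by rewrite (wactK_div u _ (wactS_neq0 v b0)) (wactSM u v a) (wactSM u v b).
Qed.

Definition in_rootloc : pred K := in_loc is_root lin.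

HB.instance Definition _ := GRing.isSubringClosed.Build K in_rootloc
  (in_loc_subring lin_root_neq0).

Record rootloc := RootLoc { rootloc_val :> K; _ : rootloc_val \in in_rootloc }.
HB.instance Definition _ := [isSub for rootloc_val].
HB.instance Definition _ := [Choice of rootloc by <:].
HB.instance Definition _ := [SubChoice_isSubComNzRing of rootloc by <:].

Definition rootloc_S (s : S) : rootloc := RootLoc (in_loc_tofrac is_root lin s).

Definition rootloc_inv a (a_root : is_root a) : rootloc :=
  RootLoc (in_loc_inv lin a_root).

Lemma wact_root w a : is_root a -> is_root (wact w a).
Proof.
move=> /existsP[x /existsP[y /andP[xy /eqP->]]].
apply/existsP; exists (sact w x); apply/existsP; exists (sact w y).
by rewrite wactD !wact_wt eqxx andbT; exact: (weyl_neq w^-1%g).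
Qed.

Lemma wactQ_subproof w (x : rootloc) : wactK w (rootloc_val x) \in in_rootloc.
Proof.
case: x => x; apply: (frac_map_loc lin_root_neq0 (@wactS_neq0 w)).
  exact: (@wact_root w).
exact: wactS_lin.
Qed.

Definition wactQ w (x : rootloc) : rootloc := RootLoc (wactQ_subproof w x).

Lemma wactQ_is_zmod_morphism w : zmod_morphism (wactQ w).
Proof. by move=> x y; apply: val_inj; rewrite /= rmorphB. Qed.

Lemma wactQ_is_monoid_morphism w : monoid_morphism (wactQ w).
Proof. by split=> [|x y]; apply: val_inj; rewrite /= ?rmorph1 ?rmorphM. Qed.

HB.instance Definition _ w := GRing.isZmodMorphism.Build rootloc rootloc (wactQ w)
  (wactQ_is_zmod_morphism w).
HB.instance Definition _ w := GRing.isMonoidMorphism.Build rootloc rootloc (wactQ w)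
  (wactQ_is_monoid_morphism w).

Lemma wactQ1 x : wactQ 1%g x = x.
Proof. by apply: val_inj; rewrite /= wactK1. Qed.

Lemma wactQM u v x : wactQ (u * v)%g x = wactQ u (wactQ v x).
Proof. by apply: val_inj; rewrite /= wactKM. Qed.

Lemma wactQ_S w s : wactQ w (rootloc_S s) = rootloc_S (wactS w s).
Proof. by apply: val_inj; exact: wactK_tofrac. Qed.

Lemma rootloc_SB : {morph rootloc_S : x y / x - y}.
Proof. by move=> x y; apply: val_inj; rewrite /= rmorphB. Qed.

Lemma rootloc_SM : {morph rootloc_S : x y / x * y}.
Proof. by move=> x y; apply: val_inj; rewrite /= rmorphM. Qed.

Lemma rootloc_S1 : rootloc_S 1 = 1.
Proof. by apply: val_inj; rewrite /= rmorph1. Qed.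

Lemma rootloc_S0 : rootloc_S 0 = 0.
Proof. by apply: val_inj; rewrite /= rmorph0. Qed.

Lemma rootlocKV a (a_root : is_root a) :
  rootloc_inv a_root * rootloc_S (lin a) = 1.
Proof.
by apply: val_inj; rewrite /= mulVf // tofrac_neq0 // lin_root_neq0.
Qed.

End Sym.

Inductive subring_gen (A : nzRingType) (G : A -> Prop) : A -> Prop :=
| SubringGen x of G x : subring_gen G x
| Subring1 : subring_gen G 1
| SubringB x y of subring_gen G x & subring_gen G y : subring_gen G (x - y)
| SubringM x y of subring_gen G x & subring_gen G y : subring_gen G (x * y).

Section Hecke.
Variable R : idomainType.
Notation S := {mpoly R[4]}.
Notation Q := (rootloc R).

(* Q_W: z stands for the sum of the z w delta_w.  A definition, so that its
   product is not the pointwise one. *)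
Definition twisted := {ffun weyl -> Q}.

HB.instance Definition _ := GRing.Zmodule.on twisted.

Implicit Types (x y z : twisted) (w : weyl).

Definition tdelta (q : Q) (w : weyl) : twisted := [ffun u => if u == w then q else 0].

Definition tmul (x y : twisted) : twisted :=
  \sum_u \sum_v tdelta (x u * wactQ u (y v)) (u * v)%g.

Lemma ffun_sumE (I J : finType) (F : I -> {ffun J -> Q}) j :
  (\sum_i F i) j = \sum_i F i j.
Proof. by rewrite sum_ffunE. Qed.

Lemma tmulE x y w : tmul x y w = \sum_u x u * wactQ u (y (u^-1 * w)%g).
Proof.
rewrite /tmul ffun_sumE; apply: eq_bigr => u _; rewrite ffun_sumE.
rewrite (bigD1 (u^-1 * w)%g) //= big1 ?addr0.
  by rewrite ffunE mulKVg eqxx.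
move=> v vn; rewrite ffunE; case: eqP => // e.
by rewrite e mulKg eqxx in vn.
Qed.

Lemma tmul_deltal q w y u : tmul (tdelta q w) y u = q * wactQ w (y (w^-1 * u)%g).
Proof.
rewrite tmulE (bigD1 w) //= big1 ?addr0 ?ffunE ?eqxx // => v /negPf vw.
by rewrite ffunE vw mul0r.
Qed.

Lemma tmul_delta q w q' w' :
  tmul (tdelta q w) (tdelta q' w') = tdelta (q * wactQ w q') (w * w')%g.
Proof.
apply/ffunP => u; rewrite tmul_deltal !ffunE -(inj_eq (mulgI w)) mulKVg.
by case: eqP => // _; rewrite rmorph0 mulr0.
Qed.

Lemma tmulA : associative tmul.
Proof.
move=> x y z; apply/ffunP => w; rewrite !tmulE.
under eq_bigr do rewrite tmulE rmorph_sum mulr_sumr /=.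
under [RHS]eq_bigr do rewrite tmulE mulr_suml.
rewrite [RHS]exchange_big /=; apply: eq_bigr => u _.
rewrite (reindex_inj (mulgI u^-1%g)) /=; apply: eq_bigr => v _.
by rewrite rmorphM /= -wactQM mulKVg invMg invgK mulrA -mulgA mulKVg.
Qed.

Lemma tmul1r : left_id (tdelta 1 1%g) tmul.
Proof. by move=> x; apply/ffunP => w; rewrite tmul_deltal mul1r wactQ1 invg1 mul1g. Qed.

Lemma tmulr1 : right_id (tdelta 1 1%g) tmul.
Proof.
move=> x; apply/ffunP => w; rewrite tmulE (bigD1 w) //= big1 ?addr0 => [|u uw].
  by rewrite ffunE mulVg eqxx rmorph1 mulr1.
rewrite ffunE; case: eqP => [e|_]; last by rewrite rmorph0 mulr0.
by case/eqP: uw; rewrite -[w](mulKVg u) e mulg1.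
Qed.

Lemma tmulDl : left_distributive tmul +%R.
Proof.
move=> x y z; apply/ffunP => w; rewrite tmulE [RHS]ffunE !tmulE -big_split.
by apply: eq_bigr => u _; rewrite ffunE mulrDl.
Qed.

Lemma tmulDr : right_distributive tmul +%R.
Proof.
move=> x y z; apply/ffunP => w; rewrite tmulE [RHS]ffunE !tmulE -big_split.
by apply: eq_bigr => u _; rewrite ffunE rmorphD mulrDr.
Qed.

Lemma tdelta_neq0 : tdelta 1 1%g != 0 :> twisted.
Proof.
by apply/eqP => /ffunP/(_ 1%g); rewrite !ffunE eqxx => /eqP; rewrite oner_eq0.
Qed.

HB.instance Definition _ := GRing.Zmodule_isNzRing.Build twisted
  tmulA tmul1r tmulr1 tmulDl tmulDr tdelta_neq0.

Definition tscal (q : Q) : twisted := tdelta q 1%g.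

(* X_a = a^-1 (1 - delta_w), to be used with w = s_a. *)
Definition demazure a (a_root : is_root a) (w : weyl) : twisted :=
  tscal (rootloc_inv R a_root) * (1 - tdelta 1 w).

(* S contains the scalars R, so subalgebras containing S are subrings. *)
Inductive hecke_gen : twisted -> Prop :=
| HeckeS (s : S) : hecke_gen (tscal (rootloc_S s))
| HeckeX a (a_root : is_root a) w of wact w =1 refl a : hecke_gen (demazure a_root w).

Definition in_hecke : pred twisted := fun z => `[< subring_gen hecke_gen z >].

Lemma in_hecke_subring : subring_closed in_hecke.
Proof.
split; first by apply/asboolP/Subring1.
- by move=> x y /asboolP Dx /asboolP Dy; apply/asboolP/SubringB.
- by move=> x y /asboolP Dx /asboolP Dy; apply/asboolP/SubringM.
Qed.

HB.instance Definition _ := GRing.isSubringClosed.Build twisted in_hecke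
  in_hecke_subring.

Record hecke := Hecke { hecke_val :> twisted; _ : hecke_val \in in_hecke }.
HB.instance Definition _ := [isSub for hecke_val].
HB.instance Definition _ := [Choice of hecke by <:].
HB.instance Definition _ := [SubChoice_isSubNzRing of hecke by <:].

(* Q_{W/W_P}; m stands for the sum of the m v delta_v. *)
Notation flagmod := {ffun minreps -> Q}.

(* Q_{W/W_P}^*, in the dual basis: f stands for the sum of the f v f_v. *)
Notation flagdual := {ffun minreps -> Q}.

Definition pairing (f : flagdual) (m : flagmod) : Q := \sum_v f v * m v.

Definition proj (z : twisted) : flagmod := [ffun v => \sum_(w | bar w == v) z w].

(* D_P = p(D), p being [proj]. *)
Definition in_DP (m : flagmod) : Prop := exists2 z, z \in in_hecke & m = proj z.

(* D_P^* = Hom_S(D_P, S), as a subset of Q_{W/W_P}^*. *)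
Definition in_DPdual : pred flagdual := fun f =>
  `[< forall m, in_DP m -> exists s : S, pairing f m = rootloc_S s >].

Definition fdelta (q : Q) (v : minreps) : flagdual :=
  [ffun u => if u == v then q else 0].

(* q delta_w (.) q' f_v = q w(q') f_{bar (w v)}, extended biadditively. *)
Definition odot (z : twisted) (f : flagdual) : flagdual :=
  \sum_w \sum_v fdelta (z w * wactQ w (f v)) (bar (w * val v)%g).

Lemma odotE z f (u : minreps) : odot z f u = \sum_w z w * wactQ w (f (bar (w^-1 * val u)%g)).
Proof.
rewrite /odot ffun_sumE; apply: eq_bigr => w _; rewrite ffun_sumE.
rewrite (bigD1 (bar (w^-1 * val u)%g)) //= big1 ?addr0.
  by rewrite ffunE barM mulKVg bar_id eqxx.
move=> v vn; rewrite ffunE; case: eqP => // e.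
by rewrite e barM mulKg bar_id eqxx in vn.
Qed.

Lemma odot_bar z f u : odot z f (bar u) = \sum_w z w * wactQ w (f (bar (w^-1 * u)%g)).
Proof. by rewrite odotE; apply: eq_bigr => w _; rewrite barM. Qed.

Lemma odotM x y f : odot (x * y) f = odot x (odot y f).
Proof.
apply/ffunP => v; rewrite !odotE.
under eq_bigr do rewrite [_ * y]/(tmul x y) tmulE mulr_suml.
under [RHS]eq_bigr do rewrite odotE rmorph_sum mulr_sumr /=.
rewrite exchange_big /=; apply: eq_bigr => u _.
rewrite (reindex_inj (mulgI u)) /=; apply: eq_bigr => w _.
by rewrite mulKg wactQM invMg -mulgA barM rmorphM /= mulrA.
Qed.

Lemma odot1 f : odot 1 f = f.
Proof.
apply/ffunP => v; rewrite odotE (bigD1 1%g) //= big1 ?addr0 => [|w /negPf w1].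
  by rewrite ffunE eqxx mul1r wactQ1 invg1 mul1g bar_id.
by rewrite ffunE w1 mul0r.
Qed.

Lemma odotDr z f g : odot z (f + g) = odot z f + odot z g.
Proof.
apply/ffunP => v; rewrite [RHS]ffunE !odotE -big_split; apply: eq_bigr => w _.
by rewrite ffunE rmorphD mulrDr.
Qed.

Lemma odotDl y z f : odot (y + z) f = odot y f + odot z f.
Proof.
apply/ffunP => v; rewrite [RHS]ffunE !odotE -big_split; apply: eq_bigr => w _.
by rewrite ffunE mulrDl.
Qed.

Lemma odotBl y z f : odot (y - z) f = odot y f - odot z f.
Proof. by apply/eqP; rewrite -subr_eq opprK -odotDl subrK. Qed.

(* Pairing against the image of z in Q_{W/W_P}. *)
Lemma pairing_proj f z : pairing f (proj z) = \sum_w f (bar w) * z w.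
Proof.
rewrite /pairing (partition_big bar xpredT) //=; apply: eq_bigr => v _.
by rewrite ffunE mulr_sumr; apply: eq_bigr => w /eqP->.
Qed.

Lemma pairingBl f g m : pairing (f - g) m = pairing f m - pairing g m.
Proof. by rewrite /pairing -sumrB; apply: eq_bigr => v _; rewrite !ffunE mulrBl. Qed.

Lemma pairing_projB f x y :
  pairing f (proj (x - y)) = pairing f (proj x) - pairing f (proj y).
Proof. by rewrite !pairing_proj -sumrB; apply: eq_bigr => v _; rewrite !ffunE mulrBr. Qed.

Lemma pairing_scal f q z : pairing f (proj (tscal q * z)) = q * pairing f (proj z).
Proof.
rewrite !pairing_proj mulr_sumr; apply: eq_bigr => w _.
by rewrite [_ * z]/(tmul _ z) tmul_deltal wactQ1 invg1 mul1g mulrCA.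
Qed.

Lemma pairing_odot q w f z : pairing (odot (tdelta q w) f) (proj z)
  = q * wactQ w (pairing f (proj (tdelta 1 w^-1%g * z))).
Proof.
rewrite !pairing_proj rmorph_sum mulr_sumr (reindex_inj (mulgI w)) /=.
apply: eq_bigr => u _; rewrite odot_bar (bigD1 w) //= big1 ?addr0; last first.
  by move=> v /negPf vw; rewrite ffunE vw mul0r.
rewrite ffunE eqxx mulKg [_ * z]/(tmul _ z) tmul_deltal mul1r rmorphM /=.
by rewrite -wactQM mulgV wactQ1 invgK mulrA.
Qed.

Lemma dot_root a : is_root a -> dot a a = 2.
Proof.
case/existsP=> x /existsP[y /andP[xy /eqP->]].
have [[n1 n2 n3] [n4 n5 n6] _ _] := sidx_neq xy.
rewrite dotDl !dotDr !dot_wt !eqxx.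
by do ?[case: eqP => ?]; try congruence.
Qed.

Lemma wact_refl_inv w a : is_root a -> wact w =1 refl a -> (w^-1 = w)%g.
Proof.
move=> a_root wE; apply/esym/eqP; rewrite eq_sym eq_invg_mul; apply/eqP.
apply: wact_faithful => l; rewrite wactM !wE wact1.
have a2 := dot_root a_root.
rewrite /refl dotDl.
have -> : dot (- (dot l a *: a)) a = - (dot l a * 2).
  rewrite -a2 /dot mulr_sumr -sumrN; apply: eq_bigr => i _.
  by rewrite !mxE mulNr mulrA.
have -> : dot l a + - (dot l a * 2) = - dot l a by ring.
by rewrite scaleNr opprK subrK.
Qed.

Lemma refl_root a : is_root a -> refl a a = - a.
Proof. by move=> /dot_root a2; rewrite /refl a2 scaler_nat mulr2n opprD addrA subrr sub0r. Qed.

Lemma in_DP_proj z : z \in in_hecke -> in_DP (proj z).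
Proof. by exists z. Qed.

Lemma in_DPdual_odot z f : z \in in_hecke -> f \in in_DPdual -> odot z f \in in_DPdual.
Proof.
move=> /asboolP Dz; elim: Dz f => {z}
  [_ [s|a a_root w wE] f|f|x y _ IHx _ IHy f|x y _ IHx _ IHy f].
- move=> /asboolP fP; apply/asboolP => _ [z zD ->].
  have [t ft] := fP _ (in_DP_proj zD).
  exists (s * t); rewrite pairing_odot wactQ1 invg1 rootloc_SM -ft.
  by rewrite -[tdelta 1 1%g]/(1 : twisted) mul1r.
- move=> /asboolP fP; apply/asboolP => _ [z zD ->].
  have XD : demazure a_root w \in in_hecke.
    by apply/asboolP/SubringGen; exact: HeckeX.
  have [t ft] := fP _ (in_DP_proj zD).
  have XzD : demazure a_root w * z \in in_hecke by rewrite rpredM.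
  have [t' ft'] := fP _ (in_DP_proj XzD).
  have [q qE] := divided_difference wE t.
  exists (q - wactS w t').
  have dE : tdelta 1 w = 1 - tscal (rootloc_S (lin R a)) * demazure a_root w.
    rewrite /demazure mulrA [_ * tscal _]tmul_delta wactQ1 mulg1 mulrC rootlocKV.
    by rewrite -[tdelta 1 1%g]/(1 : twisted) mul1r opprB addrC subrK.
  rewrite /demazure mulrBr mulr1 [_ * tdelta _ _]tmul_delta wactQ1 mulr1 mul1g.
  rewrite odotBl pairingBl !pairing_odot wactQ1 invg1.
  rewrite -[tdelta 1 1%g]/(1 : twisted) mul1r (wact_refl_inv a_root wE).
  rewrite -mulrBr ft dE mulrBl mul1r pairing_projB -mulrA pairing_scal ft ft'.
  rewrite -rootloc_SM -rootloc_SB wactQ_S rmorphB rmorphM /=.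
  rewrite wactS_lin wE refl_root // raddfN /= mulNr opprK -rootloc_SB opprD addrA qE.
  by rewrite -mulrBr rootloc_SM mulrA rootlocKV mul1r.
- by rewrite odot1.
- move=> fP; rewrite odotBl; move: (IHx f fP) (IHy f fP) => /asboolP Hx /asboolP Hy.
  apply/asboolP => m Dm; have [[s sE] [t tE]] := (Hx m Dm, Hy m Dm).
  by exists (s - t); rewrite pairingBl sE tE rootloc_SB.
- by move=> fP; rewrite odotM; apply/IHx/IHy.
Qed.

Lemma in_DPdual_zmod : zmod_closed in_DPdual.
Proof.
split.
  apply/asboolP => m _; exists 0; rewrite rootloc_S0 /pairing big1 // => v _.
  by rewrite ffunE mul0r.
move=> f g /asboolP Hf /asboolP Hg; apply/asboolP => m Dm.
have [[s sE] [t tE]] := (Hf m Dm, Hg m Dm).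
by exists (s - t); rewrite pairingBl sE tE rootloc_SB.
Qed.

HB.instance Definition _ := GRing.isZmodClosed.Build flagdual in_DPdual in_DPdual_zmod.

Record DPdual := DPDual { DPdual_val :> flagdual; _ : DPdual_val \in in_DPdual }.
HB.instance Definition _ := [isSub for DPdual_val].
HB.instance Definition _ := [Choice of DPdual by <:].
HB.instance Definition _ := [SubChoice_isSubZmodule of DPdual by <:].

Lemma DPdual_scale_subproof (d : hecke) (f : DPdual) :
  odot (hecke_val d) (DPdual_val f) \in in_DPdual.
Proof. by case: d f => [z zD] [f fP]; exact: in_DPdual_odot. Qed.

Definition DPdual_scale (d : hecke) (f : DPdual) : DPdual :=
  DPDual (DPdual_scale_subproof d f).

Lemma DPdual_scaleA d e f :
  DPdual_scale d (DPdual_scale e f) = DPdual_scale (d * e) f.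
Proof. by apply: val_inj; rewrite /= odotM. Qed.

Lemma DPdual_scale1 : left_id 1 DPdual_scale.
Proof. by move=> f; apply: val_inj; rewrite /= odot1. Qed.

Lemma DPdual_scaleDr : right_distributive DPdual_scale +%R.
Proof. by move=> d f g; apply: val_inj; rewrite /= odotDr. Qed.

Lemma DPdual_scaleDl f : {morph DPdual_scale^~ f : d e / d + e}.
Proof. by move=> d e; apply: val_inj; rewrite /= odotDl. Qed.

HB.instance Definition _ := GRing.Zmodule_isLmodule.Build hecke DPdual
  DPdual_scaleA DPdual_scale1 DPdual_scaleDr DPdual_scaleDl.

End Hecke.

Definition indecomposable (A : nzRingType) (M : lmodType A) : Prop :=
  forall e : {linear M -> M}, (forall x, e (e x) = e x) ->
    (forall x, e x = 0) \/ (forall x, e x = x).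

(* Main.v *)
Require Import Defs.
From HB Require Import structures.
From mathcomp Require Import all_boot all_order all_algebra all_fingroup.
From mathcomp Require Import boolp mpoly ring.

(** Modulo 2 the signs disappear: the weights eps_i and - eps_i have the same
    image in S, so W acts on S through its quotient S_4 and the subgroup N of
    even sign changes acts trivially.  After inverting an element of S, D_P^* is
    the space of functions on the eight weights +- eps_i, and a D-endomorphism e
    is a W-equivariant matrix indexed by weights.  Invariance under N leaves
    little room: writing t = 1 + tau, where tau exchanges x and - x (so that
    t^2 = 0 in characteristic 2), the 2 x 2 block of e at a pair of distinct
    indices i, j is a multiple of t, and the block at i is congruent modulo t to
    a scalar, the residue of e at i.  Modulo the nilpotent ideal (t) the matrix is
    thus diagonal, with residues permuted by S_4.  If e is idempotent, each
    residue is an idempotent of a domain, hence 0 or 1 ([residue_cases]), and it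
    is the same for all i.  If it is 0, the entries of e lie in (t), so
    e = e^2 lies in (t^2) = 0 ([residue0_endo0]); if it is 1, the same applies
    to 1 - e.

    This needs D_P^* to have full rank, i.e. to contain a nonzero multiple of the
    function supported at any given weight.  Divisibility conditions along the
    roots cannot supply it, because eps_i + eps_j and eps_i - eps_j coincide modulo
    2.  Instead [quadric_class] lists the equivariant Chow classes p(h) + q(h) l of
    the quadric, h being the hyperplane class and l the class of a maximal isotropic
    subspace; their span is stable under all operators X_a ([quadric_class_diff]),
    and stability together with integrality at one point forces membership in D_P^*
    ([in_DPdual_stable]).  A suitable q makes the class vanish at all points
    but one ([point_exists]). *)

Set Implicit Arguments.
Unset Strict Implicit.
Unset Printing Implicit Defensive.

Import GRing.Theory.

Local Open Scope ring_scope.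

Local Notation o k := (@Ordinal 4 k isT).
Local Notation S := {mpoly 'F_2[4]}.
Local Notation M := (DPdual 'F_2).

(** * The cosets of the parabolic subgroup as weights *)

Definition top_weight : sidx := (o 0, false).

(** An explicit list: the canonical enumeration of [sidx] does not reduce, and the
    tables below are checked by evaluation. *)
Definition weights : seq sidx :=
  [:: (o 0, false); (o 1, false); (o 2, false); (o 3, false);
      (o 3, true); (o 2, true); (o 1, true); (o 0, true)].

Lemma mem_weights x : x \in weights.
Proof.
by case: x => [[[|[|[|[|//]]]] lti] []]; rewrite (bool_irrelevance lti isT).
Qed.

Lemma mem_simple (i : 'I_4) : i \in [:: o 0; o 1; o 2; o 3].
Proof. by case: i => [[|[|[|[|//]]]] lti]; rewrite (bool_irrelevance lti isT). Qed.

(** The permutation [refl_perm] of the weights as a function that evaluates. *)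
Definition weight_refl (xy : sidx * sidx) (z : sidx) : sidx :=
  let: (x, y) := xy in if z == x then sneg y else if z == y then sneg x
    else if z == sneg x then y else if z == sneg y then x else z.

Lemma sact_simple i z : sact (simple_refl i) z = weight_refl (simple_pair i) z.
Proof.
rewrite /sact -[(sgval _)^-1%g]/(sgval (simple_refl i)^-1%g) simple_reflV /=.
by have := simple_pair_neq i; case: (simple_pair i) => x y /refl_permE->.
Qed.

Lemma sact_inj u v : sact u =1 sact v -> u = v.
Proof. by move=> uv; apply/invg_inj/val_inj/permP => x; apply: uv. Qed.

Definition word (t : seq 'I_4) : weyl := (\prod_(i <- t) simple_refl i)%g.

Definition wordact (t : seq 'I_4) (z : sidx) : sidx :=
  foldr (fun i => weight_refl (simple_pair i)) z t.

Lemma sact_word t z : sact (word t) z = wordact t z.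
Proof.
elim: t => [|i t IHt]; first by rewrite /word big_nil sact1.
by rewrite /word big_cons sactM -/(word t) IHt sact_simple.
Qed.

(** Words leading from eps_1 to each weight along the Hasse diagram of the quadric;
    they are listed in the order of [weights]. *)
Definition weight_word (x : sidx) : seq 'I_4 :=
  nth [::] [:: [::]; [:: o 0]; [:: o 1; o 0]; [:: o 2; o 1; o 0];
    [:: o 3; o 1; o 0]; [:: o 3; o 2; o 1; o 0]; [:: o 1; o 3; o 2; o 1; o 0];
    [:: o 0; o 1; o 3; o 2; o 1; o 0]] (index x weights).

Definition weight_rep x : weyl := word (weight_word x).

Lemma sact_weight_rep x : sact (weight_rep x) top_weight = x.
Proof.
rewrite sact_word; apply/eqP; move: x (mem_weights x); apply/allP.
by vm_compute.
Qed.

(** In the Hasse diagram of the quadric s_i either moves the weight x along an edge,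
    and then t is empty, or fixes it, and then s_i is conjugated by the
    representative of x to one of the generators of W_P. *)
Lemma weight_word_table : all (fun i => all (fun x => has (fun t =>
    all (fun j => j != 0) t && all (fun z => wordact (i :: weight_word x) z
      == wordact (weight_word (weight_refl (simple_pair i) x) ++ t) z) weights)
  [:: [::]; [:: o 1]; [:: o 2]; [:: o 3]]) weights) [:: o 0; o 1; o 2; o 3].
Proof. by vm_compute. Qed.

Lemma simple_weight_rep i x : exists2 u, u \in parabolic &
  (simple_refl i * weight_rep x = weight_rep (sact (simple_refl i) x) * u)%g.
Proof.
have /hasP[t _ /andP[/allP t0 /allP tP]] :=
  allP (allP weight_word_table i (mem_simple i)) x (mem_weights x).
exists (word t).
  rewrite /word big_seq; apply: group_prod => j /t0 j0.
  by apply/mem_gen/imset_f; rewrite inE.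
apply: sact_inj => z; move/eqP: (tP z (mem_weights z)).
rewrite /= {1}/wordact /= /wordact foldr_cat -!/(wordact _ _) => tz.
by rewrite !sactM !sact_simple !sact_word tz.
Qed.

(** This contains the nontrivial inclusion: the stabilizer of eps_1 is no larger
    than W_P. *)
Lemma weight_rep_coset w :
  (w \in weight_rep (sact w top_weight) *: parabolic)%g.
Proof.
have [n /existsP[t /eqP->]] := weyl_word w; rewrite -/(word t).
elim: (tval t) => [|i s IHs] {n t w}.
  rewrite /word big_nil sact1.
  have -> : weight_rep top_weight = 1%g by rewrite /weight_rep /word big_nil.
  exact: lcoset_refl.
have -> : word (i :: s) = (simple_refl i * word s)%g by rewrite /word big_cons.
have /lcosetP[u uP e] := IHs; rewrite sactM {1}e mulgA.
have [v vP ->] := simple_weight_rep i (sact (word s) top_weight).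
by rewrite -mulgA mem_lcoset mulKg groupM.
Qed.

Lemma parabolic_fix u : u \in parabolic -> sact u top_weight = top_weight.
Proof.
case/gen_prodgP=> n [c cA ->].
elim/big_ind: _ => [|v v' hv hv'|i _]; first by rewrite sact1.
  by rewrite sactM hv'.
have /imsetP[j] := cA i; rewrite inE => j0 ->; apply/eqP.
rewrite sact_simple; move: j0; apply/implyP; move: j (mem_simple j) {cA}.
by apply/allP; vm_compute.
Qed.

Lemma sact_bar w : sact (val (bar w)) top_weight = sact w top_weight.
Proof.
have /lcosetP[u uP e] := minrep_in w.
by rewrite -[val (bar w)]/(minrep w) e sactM parabolic_fix.
Qed.

Lemma bar_eq w w' : sact w top_weight = sact w' top_weight -> bar w = bar w'.
Proof.
move=> ww'; apply: val_inj => /=; apply: minrep_eq.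
have /lcoset_eqP-> := weight_rep_coset w.
by have /lcoset_eqP-> := weight_rep_coset w'; rewrite ww'.
Qed.

Definition flag_pt (x : sidx) : minreps := bar (weight_rep x).

Definition flag_wt (v : minreps) : sidx := sact (val v) top_weight.

Lemma flag_ptK : cancel flag_pt flag_wt.
Proof. by move=> x; rewrite /flag_wt sact_bar sact_weight_rep. Qed.

Lemma bar_flag_pt w : bar w = flag_pt (sact w top_weight).
Proof. by apply: bar_eq; rewrite sact_weight_rep. Qed.

Lemma flag_wtK : cancel flag_wt flag_pt.
Proof. by move=> v; rewrite -{2}(bar_id v) bar_flag_pt. Qed.

Lemma bar_mul_flag_pt w x : bar (w * val (flag_pt x))%g = flag_pt (sact w x).
Proof. by rewrite bar_flag_pt sactM -/(flag_wt _) flag_ptK. Qed.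

(** * The action of W on weights and on S modulo 2 *)

Lemma sact_refl x y w : x.1 != y.1 -> wact w =1 refl (wt x + wt y) ->
  sact w =1 weight_refl (x, y).
Proof.
move=> xy wE z; apply: wt_inj.
by rewrite -wact_wt wE -wt_refl_perm // refl_permE.
Qed.

Lemma is_root_wt x y : x.1 != y.1 -> is_root (wt x + wt y).
Proof.
by move=> xy; apply/existsP; exists x; apply/existsP; exists y; rewrite xy /=.
Qed.

Lemma sact_neq w x y : x.1 != y.1 -> (sact w x).1 != (sact w y).1.
Proof. exact: (weyl_neq w^-1%g). Qed.

(** The product of the reflections in eps_i + eps_j and eps_i - eps_j changes two
    signs; these elements of W generate the subgroup acting trivially on S. *)
Definition flip2 i j (z : sidx) :=
  if (z.1 == i) || (z.1 == j) then sneg z else z.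

Lemma flip2_table : all (fun i => all (fun j => all (fun z => (i != j) ==>
    (weight_refl ((i, false), (j, false)) (weight_refl ((i, false), (j, true)) z)
      == flip2 i j z)) weights) [:: o 0; o 1; o 2; o 3]) [:: o 0; o 1; o 2; o 3].
Proof. by vm_compute. Qed.

Lemma flip2_weyl i j : i != j -> exists w, sact w =1 flip2 i j.
Proof.
move=> ij; pose x b : sidx := (i, b); pose y b : sidx := (j, b).
have [u uE] := reflection_exists (@is_root_wt (x false) (y false) ij).
have [v vE] := reflection_exists (@is_root_wt (x false) (y true) ij).
exists (u * v)%g => z.
rewrite sactM (sact_refl _ uE) // (sact_refl _ vE) //.
have := allP (allP (allP flip2_table i (mem_simple i)) j (mem_simple j)) z
  (mem_weights z).
by rewrite ij => /eqP.
Qed.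

Lemma addS2 (p : S) : p + p = 0.
Proof.
rewrite -mulr2n -scaler_nat (_ : 2%:R = 0 :> 'F_2) ?scale0r //.
by apply/eqP.
Qed.

Lemma oppS2 (p : S) : - p = p.
Proof. by apply/esym/eqP; rewrite -addr_eq0 addS2. Qed.

Lemma lin_wt x : lin 'F_2 (wt x) = 'X_(x.1).
Proof.
case: x => i b; rewrite /wt linZ lin_eps rmorphXn rmorphN1 /=.
by case: b; rewrite ?scale1r // expr1 scaleN1r oppS2.
Qed.

Lemma wactS_var w x : wactS w ('X_(x.1) : S) = 'X_((sact w x).1).
Proof. by rewrite -!lin_wt wactS_lin wact_wt. Qed.

Lemma wactS_flip2 i j w : sact w =1 flip2 i j -> forall p : S, wactS w p = p.
Proof.
move=> wE; elim/S_ind => [c|k|p q IHp IHq|p q IHp IHq].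
- by rewrite wactSC.
- rewrite (wactS_var w (k, false)) wE /flip2.
  by case: ifP.
- by rewrite rmorphD /= IHp IHq.
- by rewrite rmorphM /= IHp IHq.
Qed.

Definition cofactor_poly (i : 'I_4) : {poly S} :=
  \prod_(k | k != i) ('X - ('X_k)%:P).

Lemma map_cofactor_poly w x :
  map_poly (wactS w) (cofactor_poly x.1) = cofactor_poly (sact w x).1.
Proof.
pose h i := (sact w (i, false)).1.
have h_inj : injective h.
  move=> i j /eqP; apply: contraTeq => ij.
  exact: (@sact_neq w (i, false) (j, false) ij).
have hE y : (sact w y).1 = h y.1.
  case: y => i [] //; rewrite -[(i, true)]/(sneg (i, false)) sact_sneg //.
rewrite /cofactor_poly rmorph_prod hE /= [RHS](reindex_inj h_inj) /=.
apply: eq_big => [k|k _]; first by rewrite (inj_eq h_inj).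
by rewrite map_polyXsubC /= (wactS_var w (k, false)).
Qed.

(** The product of the weights eps_i + eps_k for k <> i, that is, the Euler class at
    eps_i of the normal space to the isotropic subspace P^3 spanned by the positive
    weight vectors.  Modulo 2 the tangent space of P^3 has the same Euler class, so
    the square is that of the tangent space of the quadric. *)
Definition half_euler (i : 'I_4) : S := (cofactor_poly i).['X_i].

Lemma wactS_horner w (p : {poly S}) (s : S) :
  wactS w p.[s] = (map_poly (wactS w) p).[wactS w s].
Proof. by rewrite horner_map. Qed.

Lemma wactS_half_euler w x : wactS w (half_euler x.1) = half_euler (sact w x).1.
Proof. by rewrite /half_euler wactS_horner map_cofactor_poly wactS_var. Qed.

Lemma cofactor_poly_root i k : i != k -> (cofactor_poly i).['X_k] = 0.
Proof.
move=> ik; rewrite /cofactor_poly horner_prod; apply/eqP/prodf_eq0.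
by exists k; rewrite 1?eq_sym // hornerXsubC subrr.
Qed.

Lemma varB_neq0 (i k : 'I_4) : i != k -> 'X_i - 'X_k != 0 :> S.
Proof.
move=> ik; have := lin_root_neq0 'F_2 (@is_root_wt (i, false) (k, false) ik).
by rewrite raddfD /= !lin_wt /= oppS2.
Qed.

Lemma half_euler_neq0 i : half_euler i != 0.
Proof.
rewrite /half_euler /cofactor_poly horner_prod; apply/prodf_neq0 => k ki.
by rewrite hornerXsubC varB_neq0 // eq_sym.
Qed.

(** The right hand factor is a polynomial in h restricted to the weights: it is what
    X_a produces from l when s_a changes signs. *)
Lemma half_euler_dvd i j : i != j -> exists r : {poly S}, forall k,
  ((k == i) || (k == j))%:R * half_euler k = ('X_i + 'X_j) * r.['X_k].
Proof.
move=> ij; have ji : j != i by rewrite eq_sym.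
exists (\prod_(k | (k != i) && (k != j)) ('X - ('X_k)%:P)) => k.
have [->|ki] := eqVneq k i; last have [->|kj] := eqVneq k j;
  rewrite /= ?mul1r ?mul0r.
- rewrite /half_euler /cofactor_poly (bigD1 j ji) /= hornerM hornerXsubC.
  by rewrite (oppS2 'X_j).
- rewrite /half_euler /cofactor_poly (bigD1 i ij) /= hornerM hornerXsubC.
  rewrite (oppS2 'X_i) addrC; congr (_ * _.[_]).
  by apply: eq_bigl => m; rewrite andbC.
- apply/esym/eqP; rewrite mulf_eq0 horner_prod; apply/orP; right.
  by apply/prodf_eq0; exists k; rewrite ?ki // hornerXsubC subrr.
Qed.

(** The restriction to the weight z of p(h) + q(h) l: the hyperplane class h restricts
    to the weight itself, and the class l of the isotropic P^3 spanned by the positive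
    weight vectors restricts to the Euler class of its normal space there and to 0 at
    the negative weights. *)
Definition quadric_class (p q : {poly S}) (z : sidx) : S :=
  p.['X_z.1] + (~~ z.2)%:R * (half_euler z.1 * q.['X_z.1]).

Lemma poly_divided_difference a w : wact w =1 refl a -> forall p : {poly S},
  exists q, p - map_poly (wactS w) p = (lin 'F_2 a)%:P * q.
Proof.
move=> wE; elim/poly_ind => [|p c [q pE]].
  by exists 0; rewrite rmorph0 subrr mulr0.
have [d cE] := divided_difference wE c.
exists (q * 'X + d%:P); rewrite rmorphD rmorphM /= map_polyX map_polyC /=.
by rewrite mulrDr mulrA -pE -polyCM -cE polyCB mulrBl opprD addrACA.
Qed.

Lemma horner_divided_difference a w : wact w =1 refl a -> forall p : {poly S},
  exists q, forall s, p.[s] = (map_poly (wactS w) p).[s] + lin 'F_2 a * q.[s].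
Proof.
move=> wE p; have [q pE] := poly_divided_difference wE p; exists q => s.
rewrite -[X in _ + X * _](hornerC _ s) -hornerM -pE hornerD hornerN.
by rewrite addrC subrK.
Qed.

Lemma weight_refl_sign_table : all (fun x => all (fun y => all (fun z =>
    (x.1 != y.1) ==> ((weight_refl (x, y) z).2
      == z.2 (+) ((x.2 == y.2) && ((z.1 == x.1) || (z.1 == y.1)))))
  weights) weights) weights.
Proof. by vm_compute. Qed.

(** The reflection in +- eps_i +- eps_j changes signs exactly when the two signs
    agree. *)
Lemma weight_refl_sign x y z : x.1 != y.1 ->
  (weight_refl (x, y) z).2 = z.2 (+) ((x.2 == y.2) && ((z.1 == x.1) || (z.1 == y.1))).
Proof.
have := allP (allP (allP weight_refl_sign_table x (mem_weights x)) y (mem_weights y)) z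
  (mem_weights z).
by move=> /implyP h /h/eqP.
Qed.

Lemma quadric_class_diff_algebra (A : comNzRingType)
    (A2 : forall a : A, a + a = 0) (a p q m n t r : A) (b c e : bool) :
    c%:R * t = a * r ->
  m + a * p + (~~ b)%:R * (t * (n + a * q))
    - (m + (~~ (b (+) (e && c)))%:R * (t * n))
  = a * (p + e%:R * (r * n) + (~~ b)%:R * (t * q)).
Proof.
have oppA (x : A) : - x = x by apply/esym/eqP; rewrite -addr_eq0 A2.
rewrite !mulrDr [a * (e%:R * _)]mulrCA [a * (r * n)]mulrA => <-.
by rewrite oppA; case: b; case: e; case: c => /=; ring: (A2 m) (A2 (t * n)).
Qed.

(** Stability of the classes p(h) + q(h) l under X_a.  If s_a preserves signs it fixes
    both h and l, and X_a acts on the coefficients of p and q.  Otherwise s_a moves l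
    to the opposite isotropic subspace in two of the four directions, and
    [half_euler_dvd] turns the difference into a multiple of a. *)
Lemma quadric_class_diff x y w p q :
  x.1 != y.1 -> wact w =1 refl (wt x + wt y) ->
  exists p' q', forall z, quadric_class p q z
      - wactS w (quadric_class p q (sact w^-1%g z))
    = lin 'F_2 (wt x + wt y) * quadric_class p' q' z.
Proof.
move=> xy wE; have [r rE] := half_euler_dvd xy.
have [p' pE] := horner_divided_difference wE p.
have [q' qE] := horner_divided_difference wE q.
pose e := (x.2 == y.2).
exists (p' + (e%:R : S)%:P * (r * map_poly (wactS w) q)), q' => z.
have linE : lin 'F_2 (wt x + wt y) = 'X_(x.1) + 'X_(y.1).
  by rewrite raddfD /= !lin_wt.
have wV : (w^-1)%g = w := wact_refl_inv (is_root_wt xy) wE.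
have sw : sact w (sact w^-1%g z) = z by rewrite -sactM mulgV sact1.
rewrite /quadric_class rmorphD !rmorphM /= wactS_half_euler !wactS_horner.
rewrite !wactS_var sw.
rewrite (pE 'X_z.1) (qE 'X_z.1) wV (sact_refl xy wE) weight_refl_sign // rmorph_nat.
rewrite hornerD hornerM hornerC hornerM.
by apply: (quadric_class_diff_algebra addS2); rewrite rE linE.
Qed.

(** * A criterion for membership in the dual of D_P *)

Section Criterion.
Variable R : idomainType.
Notation flagdual := {ffun minreps -> rootloc R}.

(** Twisted Leibniz rule: left multiplication by X_a on Q_{W/W_P} is adjoint to its
    action on the dual, up to the divided difference of the value of the pairing. *)
Lemma pairing_demazure a (a_root : is_root a) w (f : flagdual) z s t :
    wact w =1 refl a -> pairing f (proj z) = rootloc_S s ->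
    pairing (odot (demazure R a_root w) f) (proj z) = rootloc_S t ->
  exists u, pairing f (proj (demazure R a_root w * z)) = rootloc_S u.
Proof.
move=> wE fz; have wV := wact_refl_inv a_root wE.
have XE : demazure R a_root w = tdelta (rootloc_inv R a_root) 1%g
    - tdelta (rootloc_inv R a_root) w.
  by rewrite /demazure mulrBr mulr1 [_ * tdelta _ _]tmul_delta wactQ1 mulr1 mul1g.
rewrite {1}XE odotBl pairingBl !pairing_odot wactQ1 invg1.
rewrite -[tdelta 1 1%g]/(1 : twisted R) mul1r wV fz -mulrBr.
rewrite /demazure -mulrA pairing_scal mulrBl mul1r pairing_projB fz.
set h := pairing f _ => tE; have [q qE] := divided_difference wE s.
have hE : wactQ w h = rootloc_S (s - lin R a * t).
  rewrite rootloc_SB rootloc_SM -tE mulrA [rootloc_S _ * _]mulrC rootlocKV.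
  by rewrite mul1r opprB addrC subrK.
exists (q - wactS w t).
have -> : h = rootloc_S (wactS w (s - lin R a * t)).
  by rewrite -wactQ_S -hE -wactQM -{1}wV mulVg wactQ1.
rewrite -rootloc_SB rmorphB rmorphM /= wactS_lin wE refl_root // raddfN /=.
rewrite mulNr opprK opprD addrA qE -mulrBr rootloc_SM mulrA rootlocKV mul1r //.
Qed.

(** Since D is generated by S and the X_a, [pairing_demazure] propagates integrality
    from the coset of 1 to all of D_P. *)
Lemma in_DPdual_stable (L : flagdual -> Prop) :
    (forall f a (a_root : is_root a) w, wact w =1 refl a -> L f ->
      L (odot (demazure R a_root w) f)) ->
    (forall f, L f -> exists s, f (bar 1%g) = rootloc_S s) ->
  forall f, L f -> f \in @in_DPdual R.
Proof.
move=> LX L1.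
suff LD z : z \in @in_hecke R -> forall x,
    (forall f, L f -> exists s, pairing f (proj x) = rootloc_S s) ->
    forall f, L f -> exists s, pairing f (proj (z * x)) = rootloc_S s.
  move=> f Lf; apply/asboolP => _ [z zD ->].
  have [g Lg|s sE] := LD z zD 1 _ f Lf; last by exists s; rewrite -sE mulr1.
  have [s sE] := L1 g Lg; exists s; rewrite -sE pairing_proj (bigD1 1%g) //=.
  rewrite big1 ?addr0 => [|w /negPf w1]; rewrite ffunE ?w1 ?eqxx ?mulr1 //.
  by rewrite mulr0.
move=> /asboolP Dz; elim: Dz => {z}
  [_ [s|a a_root w wE]||x y _ IHx _ IHy|x y _ IHx _ IHy] m mP f Lf.
- have [t tE] := mP f Lf; exists (s * t).
  by rewrite pairing_scal tE rootloc_SM.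
- have [s sE] := mP f Lf; have [t tE] := mP _ (LX f a a_root w wE Lf).
  exact: pairing_demazure wE sE tE.
- by have [s sE] := mP f Lf; exists s; rewrite mul1r.
- have [[s sE] [t tE]] := (IHx m mP f Lf, IHy m mP f Lf).
  by exists (s - t); rewrite mulrBl pairing_projB sE tE rootloc_SB.
- by rewrite -mulrA; apply: IHx => // g; apply: IHy.
Qed.

Lemma odot_tdelta q w (f : flagdual) x :
  odot (tdelta q w) f (flag_pt x) = q * wactQ w (f (flag_pt (sact w^-1%g x))).
Proof.
rewrite odotE (bigD1 w) //= big1 ?addr0 => [|u /negPf uw].
  by rewrite ffunE eqxx bar_mul_flag_pt.
by rewrite ffunE uw mul0r.
Qed.

Lemma odot_demazure a (a_root : is_root a) w (f : flagdual) x :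
  odot (demazure R a_root w) f (flag_pt x) = rootloc_inv R a_root
    * (f (flag_pt x) - wactQ w (f (flag_pt (sact w^-1%g x)))).
Proof.
rewrite odotM odot_tdelta wactQ1 invg1 sact1 odotBl odot1 !ffunE.
by rewrite odot_tdelta mul1r.
Qed.

Lemma in_hecke_scal s : tscal (rootloc_S s) \in @in_hecke R.
Proof. by apply/asboolP/SubringGen/HeckeS. Qed.

(** As s_a = 1 - a X_a. *)
Lemma in_hecke_refl a w : is_root a -> wact w =1 refl a ->
  tdelta 1 w \in @in_hecke R.
Proof.
move=> a_root wE.
rewrite (_ : tdelta 1 w = 1 - tscal (rootloc_S (lin R a)) * demazure R a_root w).
  rewrite rpredB ?rpred1 // rpredM ?in_hecke_scal //.
  by apply/asboolP/SubringGen; exact: HeckeX.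
rewrite /demazure mulrA [_ * tscal _]tmul_delta wactQ1 mulg1 mulrC rootlocKV.
by rewrite -[tdelta 1 1%g]/(1 : twisted R) mul1r opprB addrC subrK.
Qed.

Lemma in_hecke_delta w : tdelta 1 w \in @in_hecke R.
Proof.
have [n /existsP[t /eqP->]] := weyl_word w.
elim: (tval t) => [|i s IHs]; first by rewrite big_nil; exact: rpred1.
rewrite big_cons; set w1 := (\prod_(j <- s) _)%g in IHs *.
have -> : tdelta 1 (simple_refl i * w1)%g
    = tdelta 1 (simple_refl i) * tdelta 1 w1 :> twisted R.
  by rewrite [RHS]tmul_delta rmorph1 mulr1.
rewrite rpredM //.
apply: (@in_hecke_refl (simple_root i)); last exact: wact_simple_refl.
by apply/is_root_wt/simple_pair_neq.
Qed.

End Criterion.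

Lemma rootloc_S_inj (R : idomainType) : injective (@rootloc_S R).
Proof. by move=> s t /(congr1 (@rootloc_val R)) /= /eqP; rewrite tofrac_eq => /eqP. Qed.

Section Values.
Variable R : idomainType.

Notation M := (DPdual R).
Implicit Types (f g : M) (x y : sidx) (s : {mpoly R[4]}) (w : weyl).

Definition scal s : hecke R := Hecke (in_hecke_scal s).
Definition dirac w : hecke R := Hecke (in_hecke_delta R w).

Lemma DPdual_integral f x : exists s, DPdual_val f (flag_pt x) == rootloc_S s.
Proof.
have /asboolP fP := valP f.
have [s sE] := fP _ (in_DP_proj (in_hecke_delta R (weight_rep x))).
exists s; rewrite -sE pairing_proj (bigD1 (weight_rep x)) //= big1 ?addr0.
  by rewrite ffunE eqxx mulr1.
by move=> w /negPf wx; rewrite ffunE wx mulr0.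
Qed.

(** Opaque, so that unification does not unfold the choice. *)
Lemma loc_sig f :
  {l : sidx -> {mpoly R[4]} |
    forall x, DPdual_val f (flag_pt x) = rootloc_S (l x)}.
Proof.
exists (fun x => xchoose (DPdual_integral f x)) => x.
exact/eqP/(xchooseP (DPdual_integral f x)).
Qed.

(** Localization at the fixed points of G/P: through it D_P^* becomes a module of
    S-valued functions on the weights. *)
Definition loc f : sidx -> {mpoly R[4]} := sval (loc_sig f).

Lemma locE f x : DPdual_val f (flag_pt x) = rootloc_S (loc f x).
Proof. exact: (svalP (loc_sig f)). Qed.

Lemma loc_inj f g : loc f =1 loc g -> f = g.
Proof.
by move=> fg; apply/val_inj/ffunP => v; rewrite -(flag_wtK v) /= !locE fg.
Qed.

Lemma locB x : {morph loc^~ x : f g / f - g}.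
Proof.
move=> f g; apply: (@rootloc_S_inj R); rewrite (rootloc_SB (loc f x)) -!locE.
by rewrite -[DPdual_val (f - g)]/(DPdual_val f - DPdual_val g) !ffunE.
Qed.

Lemma loc0 x : loc 0 x = 0.
Proof. by rewrite -(subrr 0) locB subrr. Qed.

Lemma locD x : {morph loc^~ x : f g / f + g}.
Proof. by move=> f g; rewrite -{1}(opprK g) -(sub0r g) !locB loc0 sub0r opprK. Qed.

Lemma loc_sum x (I : finType) (F : I -> M) :
  loc (\sum_i F i) x = \sum_i loc (F i) x.
Proof. exact: (big_morph _ (locD x) (loc0 x)). Qed.

Lemma loc_scal s f x : loc (scal s *: f) x = s * loc f x.
Proof.
apply: (@rootloc_S_inj R); rewrite (rootloc_SM s) -!locE.
by rewrite [LHS]odot_tdelta wactQ1 invg1 sact1.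
Qed.

Lemma loc_dirac w f x : loc (dirac w *: f) (sact w x) = wactS w (loc f x).
Proof.
apply: (@rootloc_S_inj R); rewrite -wactQ_S -!locE.
by rewrite [LHS]odot_tdelta mul1r -sactM mulVg sact1.
Qed.

End Values.

(** * Classes supported at a single weight *)

Definition quadric_fun (p q : {poly S}) : {ffun minreps -> rootloc 'F_2} :=
  [ffun v => rootloc_S (quadric_class p q (flag_wt v))].

Lemma quadric_fun_in_DPdual p q : quadric_fun p q \in @in_DPdual 'F_2.
Proof.
apply: (@in_DPdual_stable _ (fun f => exists p q, f = quadric_fun p q));
  last by exists p, q.
- move=> _ a a_root w wE [{}p [{}q ->]].
  have /existsP[x /existsP[y /andP[xy /eqP aE]]] := a_root.
  have [p' [q' pqE]] : exists p' q', forall z, quadric_class p q z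
      - wactS w (quadric_class p q (sact w^-1%g z))
      = lin 'F_2 a * quadric_class p' q' z.
    by rewrite aE; apply: (quadric_class_diff _ _ xy); rewrite -aE.
  exists p', q'; apply/ffunP => v; rewrite -(flag_wtK v) odot_demazure.
  rewrite !ffunE !flag_ptK.
  by rewrite wactQ_S -rootloc_SB pqE rootloc_SM mulrA rootlocKV mul1r.
- by move=> _ [{}p [{}q ->]]; rewrite ffunE; eexists.
Qed.

(** The norm over W of the Euler class at eps_1 of the tangent space; the norm makes it
    W-invariant, so that one multiplier serves all weights. *)
Definition euler_norm : S := (\prod_(w : weyl) wactS w (half_euler 0)) ^+ 2.

Lemma euler_norm_neq0 : euler_norm != 0.
Proof.
rewrite expf_neq0 //; apply/prodf_neq0 => w _.
by rewrite wactS_neq0 // half_euler_neq0.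
Qed.

Lemma wactS_euler_norm w : wactS w euler_norm = euler_norm.
Proof.
suff e : wactS w (\prod_(u : weyl) wactS u (half_euler 0))
    = \prod_(u : weyl) wactS u (half_euler 0).
  by rewrite /euler_norm rmorphXn; congr (_ ^+ 2).
rewrite [RHS](reindex_inj (mulgI w)) rmorph_prod.
by apply: eq_bigr => u _; rewrite (wactSM w u).
Qed.

(** The class l is supported at the positive weights, and q(h) vanishes at the weights
    other than +- eps_1 when q is a multiple of [cofactor_poly 0]. *)
Lemma quadric_class_top_weight : exists q, forall x,
  quadric_class 0 q x = if x == top_weight then euler_norm else 0.
Proof.
pose c := \prod_(w : weyl | w != 1%g) wactS w (half_euler 0).
have cE : euler_norm = half_euler 0 * (half_euler 0 * c ^+ 2).
  by rewrite /euler_norm (bigD1 1%g) //= wactS1 -/c exprMn expr2 mulrA.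
exists (cofactor_poly 0 * (c ^+ 2)%:P) => x.
rewrite /quadric_class horner0 add0r hornerM hornerC.
case: (eqVneq x top_weight) => [->|x_top] /=; first by rewrite mul1r cE.
have [x0|x0] := eqVneq x.1 0; last first.
  by rewrite cofactor_poly_root 1?eq_sym // mul0r !mulr0.
have -> : x.2 = true; last by rewrite mul0r.
by case: x x0 x_top => i [] //= ->.
Qed.

Lemma point_exists x : exists f : M,
  forall y, loc f y = if y == x then euler_norm else 0.
Proof.
have [q qE] := quadric_class_top_weight.
pose f := DPDual (quadric_fun_in_DPdual 0 q).
have fE y : loc f y = if y == top_weight then euler_norm else 0.
  by apply: (@rootloc_S_inj 'F_2); rewrite -locE /= ffunE flag_ptK qE.
exists (dirac 'F_2 (weight_rep x) *: f) => y; pose u := weight_rep x.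
have uVx : sact u^-1%g x = top_weight.
  by rewrite -(sact_weight_rep x) -sactM mulVg sact1.
have uVK z : sact u (sact u^-1%g z) = z by rewrite -sactM mulgV sact1.
rewrite -{1}(uVK y) loc_dirac fE -uVx (inj_eq (can_inj uVK)).
by case: ifP => _; [exact: wactS_euler_norm | rewrite rmorph0].
Qed.

(** * Endomorphisms as matrices indexed by weights *)

Definition point x : M := sval (cid (point_exists x)).

Lemma loc_point x y : loc (point x) y = if y == x then euler_norm else 0.
Proof. by rewrite /point; case: cid. Qed.

Lemma dirac_point w x : dirac 'F_2 w *: point x = point (sact w x).
Proof.
apply: loc_inj => y.
have wVK z : sact w (sact w^-1%g z) = z by rewrite -sactM mulgV sact1.
have wKV z : sact w^-1%g (sact w z) = z by rewrite -sactM mulVg sact1.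
rewrite -(wVK y) loc_dirac !loc_point (inj_eq (can_inj wKV)).
by case: ifP => _; [exact: wactS_euler_norm | rewrite rmorph0].
Qed.

Lemma point_expand (f : M) :
  scal euler_norm *: f = \sum_x scal (loc f x) *: point x.
Proof.
apply: loc_inj => y; rewrite loc_scal loc_sum (bigD1 y) //= big1 ?addr0.
  by rewrite loc_scal loc_point eqxx mulrC.
by move=> x /negPf xy; rewrite loc_scal loc_point eq_sym xy mulr0.
Qed.

Lemma third_index (i j : 'I_4) : exists k, (i != k) && (j != k).
Proof.
have tab : all (fun i => all (fun j => has (fun k => (i != k) && (j != k))
    [:: o 0; o 1; o 2]) [:: o 0; o 1; o 2; o 3]) [:: o 0; o 1; o 2; o 3].
  by vm_compute.
have /hasP[k _ kP] := allP (allP tab i (mem_simple i)) j (mem_simple j).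
by exists k.
Qed.

Section Endomorphism.
Variable e : {linear M -> M}.

(** The matrix of e in the basis of functions supported at one weight, multiplied by
    [euler_norm]. *)
Definition entry y x : S := loc (e (point x)) y.

Lemma loc_endo f y : euler_norm * loc (e f) y = \sum_x loc f x * entry y x.
Proof.
rewrite -loc_scal -linearZ point_expand linear_sum loc_sum.
by apply: eq_bigr => x _; rewrite /= linearZ_LR loc_scal.
Qed.

Lemma entry_sact w y x : entry (sact w y) (sact w x) = wactS w (entry y x).
Proof. by rewrite /entry -dirac_point linearZ_LR /= loc_dirac. Qed.

(** Equivariance becomes invariance, because [flip2] acts trivially on S. *)
Lemma entry_flip2 i j y x :
  i != j -> entry (flip2 i j y) (flip2 i j x) = entry y x.
Proof. by move=> /flip2_weyl[w wE]; rewrite -!wE entry_sact (wactS_flip2 wE). Qed.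

Lemma entry_sneg y x : entry (sneg y) (sneg x) = entry y x.
Proof.
have [yx|yx] := eqVneq y.1 x.1.
  have [k /andP[yk _]] := third_index y.1 y.1.
  by rewrite -(entry_flip2 y x yk) /flip2 -yx eqxx.
by rewrite -(entry_flip2 y x yx) /flip2 !eqxx orbT.
Qed.

(** With four indices there is a third one, k, whose sign can be changed along with
    that of y without affecting x. *)
Lemma entry_snegl y x : y.1 != x.1 -> entry (sneg y) x = entry y x.
Proof.
move=> yx; have [k /andP[yk xk]] := third_index y.1 x.1.
by rewrite -(entry_flip2 y x yk) /flip2 eqxx /= (eq_sym x.1) (negPf yx) (negPf xk).
Qed.

(** The block of e at +- x modulo t = 1 + tau: tau becomes 1, so that the two entries of
    a column are added. *)
Definition residue x : S := entry x x + entry (sneg x) x.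

Lemma residue_sact w x : residue (sact w x) = wactS w (residue x).
Proof. by rewrite /residue -sact_sneg !entry_sact rmorphD. Qed.

Hypothesis e_idem : forall x, e (e x) = e x.

Lemma entry_sqr y x :
  euler_norm * entry y x = \sum_z entry z x * entry y z.
Proof. by rewrite {1}/entry -e_idem loc_endo. Qed.

(** Passing to the residue is multiplicative: outside +- x, the entries of the two rows
    x and - x cancel in characteristic 2.  The factor [euler_norm] comes from the
    normalization of the entries. *)
Lemma residue_sqr x : euler_norm * residue x = residue x ^+ 2.
Proof.
rewrite mulrDr !entry_sqr -big_split /= (bigD1 x) //= (bigD1 (sneg x)) /=;
  last first.
  by rewrite eq_sym sneg_neq.
rewrite big1 ?addr0 => [|z /andP[zx zsx]].
  have := entry_sneg x x; have := entry_sneg (sneg x) x; rewrite snegK => -> ->.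
  by rewrite -!mulrDr [entry (sneg x) x + _]addrC -/(residue x) -mulrDl.
rewrite -mulrDr [entry (sneg x) z]entry_snegl ?addS2 ?mulr0 //.
case: x z zx zsx => i [] [j []]; rewrite -!pair_eqE /pair_eq /= ?andbT ?andbF //=.
all: by rewrite eq_sym.
Qed.

Lemma residue_cases x : residue x = 0 \/ residue x = euler_norm.
Proof.
have /eqP := residue_sqr x; rewrite expr2 -subr_eq0 -mulrBl mulf_eq0 subr_eq0.
by case/orP=> /eqP; [right | left].
Qed.

(** With zero residues all entries are unchanged by a sign change in either index,
    i.e. e is a multiple of t, so that the terms of e^2 at z and - z cancel. *)
Lemma residue0_endo0 : residue top_weight = 0 -> forall f, e f = 0.
Proof.
move=> res0; have {res0} res0 x : residue x = 0.
  by rewrite -(sact_weight_rep x) residue_sact res0 rmorph0.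
have snegl y x : entry (sneg y) x = entry y x.
  have [yx|/entry_snegl//] := eqVneq y.1 x.1.
  have eN z : entry (sneg z) z = entry z z.
    by apply/eqP; rewrite -[X in _ == X]oppS2 -addr_eq0 addrC -/(residue z) res0.
  have [->|y_x] := eqVneq y x; first exact: eN.
  have -> : y = sneg x; last by rewrite snegK eN.
  case: x y yx y_x => i b [j c] /= ->; rewrite /sneg /=.
  by case: b; case: c; rewrite ?eqxx.
have snegr y x : entry y (sneg x) = entry y x.
  by rewrite -entry_sneg snegK snegl.
have entry0 y x : entry y x = 0.
  apply: (mulfI euler_norm_neq0); rewrite entry_sqr mulr0.
  pose F z := entry z x * entry y z.
  rewrite (_ : \sum_z _ = \sum_i \sum_b F (i, b)); last first.
    by rewrite pair_bigA; apply: eq_bigr => -[].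
  have F0 i : \sum_b F (i, b) = 0.
    rewrite big_bool /F -[(i, true)]/(sneg (i, false)) snegr snegl.
    exact: addS2.
  by rewrite big1.
move=> f; apply: loc_inj => y; apply: (mulfI euler_norm_neq0).
rewrite loc_endo loc0 mulr0; apply: big1 => x _.
by rewrite entry0 mulr0.
Qed.

End Endomorphism.

Theorem proposition7p10 : indecomposable (DPdual 'F_2).
Proof.
move=> e e_idem.
have [res0|res1] := residue_cases e_idem top_weight.
  by left; apply: residue0_endo0.
(* The residue of 1 - e vanishes. *)
right=> f; pose e' : {linear M -> M} := idfun \- e.
have e'_idem g : e' (e' g) = e' g.
  by rewrite /= linearB e_idem subrr subr0.
apply/esym/eqP; rewrite -subr_eq0; apply/eqP.
apply: (residue0_endo0 e'_idem); rewrite /residue /entry /= !locB !loc_point eqxx.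
rewrite eq_sym sneg_neq sub0r oppS2 -addrA.
rewrite [X in _ + X](_ : _ = residue e top_weight); last first.
  by rewrite /residue oppS2.
by rewrite res1 addS2.
Qed.
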